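(* Let $n\ge1$ and $1\le M\le 2^{n-1}$ be integers and set $a:=M/2^{n}$ (so $0<a\le 1/2$). Then every $A\subseteq\{-1,1\}^{n}$ with $|A|=M$ satisfies \[ D(A)\;\ge\;\frac{n}{2}-\varphi(a),\qquad\text{where }\ \varphi(a):=\begin{cases}\frac{1}{\sqrt{a}}-1, & 0< a\le\frac14,\\[2pt] \frac{1}{4a}, & \frac14<a\le\frac12.\end{cases} \]
   Context: For a nonempty set (code) $A\subseteq\{-1,1\}^{n}$, its average distance is $D(A):=\frac{1}{|A|^{2}}\sum_{(\mathbf{x},\mathbf{x}')\in A^{2}}d_{\mathrm{H}}(\mathbf{x},\mathbf{x}')$, where $d_{\mathrm{H}}(\mathbf{x},\mathbf{x}')=|\{i:x_i\neq x_i'\}|$ is the Hamming distance. *)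

(* Defs.v *)
(* The cube {-1,1}^n is encoded as {ffun 'I_n -> bool}
   (true <-> +1, false <-> -1); Hamming distance only depends on equality
   of coordinates, so this encoding is exact. *)
From HB Require Import structures.
From mathcomp Require Import all_boot all_order all_algebra.
Set Implicit Arguments. Unset Strict Implicit. Unset Printing Implicit Defensive.
Import Order.TTheory GRing.Theory Num.Theory.
Local Open Scope ring_scope.

Definition cube (n : nat) := {ffun 'I_n -> bool}.

Definition dH (n : nat) (x y : cube n) : nat := #|[set i | x i != y i]|.

Definition avg_dist (R : numFieldType) (n : nat) (A : {set cube n}) : R :=
  (\sum_(x in A) \sum_(y in A) (dH x y)%:R) / (#|A| ^ 2)%:R.

Definition phi (R : rcfType) (a : R) : R :=
  if a <= 4^-1 then (Num.sqrt a)^-1 - 1 else (4 * a)^-1.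

(* Main.v *)
(* For 0 <= rho <= 1 the noise kernel prod_i (1 - rho x_i y_i) is nonnegative,
   and its Fourier coefficient at S is (-rho)^|S|, which equals 1 for S empty,
   - rho for |S| = 1 and is at most rho^2 for |S| >= 2.  Summing over A x A and
   using Parseval to control the levels >= 2 by the total Fourier weight yields
     n/2 - D(A) <= (rho^2 / a + 1 - rho^2) / (2 rho (1 + rho)).
   The optimal choice is rho = sqrt a / (1 - sqrt a) for a <= 1/4 and rho = 1
   (the antipodal kernel) otherwise. *)
Require Import Defs.
From HB Require Import structures.
From mathcomp Require Import all_boot all_order all_algebra.
From mathcomp Require Import ring lra.
Import Order.TTheory GRing.Theory Num.Theory.
Local Open Scope ring_scope.

Definition spin {R : pzRingType} {n} (x : cube n) (i : 'I_n) : R := (-1) ^+ (~~ x i).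

Definition walsh {R : comPzRingType} {n} (S : {set 'I_n}) (x : cube n) : R :=
  \prod_(i in S) spin x i.

Lemma spin_mul (R : pzRingType) n (x y : cube n) i :
  spin x i * spin y i = 1 - (x i != y i)%:R *+ 2 :> R.
Proof.
rewrite /spin; case: (x i); case: (y i);
  by rewrite /= ?expr0 ?expr1 ?mulrNN ?mulr1 ?mul1r ?mul0rn ?subr0 // mulr2n opprD addNKr.
Qed.

Lemma sum_spin_mul (R : comPzRingType) n (x y : cube n) :
  \sum_i spin x i * spin y i = n%:R - (dH x y)%:R *+ 2 :> R.
Proof.
under eq_bigr do rewrite spin_mul.
rewrite sumrB sumr_const card_ord sumrMnl /dH -sum1_card natr_sum.
by rewrite [in RHS]big_mkcond; congr (_ - _ *+ 2); apply: eq_bigr => i _;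
  rewrite inE; case: (x i != y i).
Qed.

(** Fourier expansion of the noise kernel: [S] records the factors from which the spin term, rather
    than 1, is taken. *)
Lemma prod_noise (R : comPzRingType) n (c : R) (x y : cube n) :
  \prod_i (1 + c * (spin x i * spin y i)) =
  \sum_(S : {set 'I_n}) c ^+ #|S| * (walsh S x * walsh S y).
Proof.
under eq_bigr do rewrite addrC.
rewrite bigA_distr; apply: eq_bigr => S _.
by rewrite -big_mkcond /= !big_split /= prodr_const.
Qed.

(** Parseval in kernel form: a coordinate where [x] and [y] differ contributes a zero factor. With
    [prod_noise] at [c = 1], constant Fourier weight gives the diagonal kernel. *)
Lemma prod_noise1 (R : comPzRingType) n (x y : cube n) :
  \prod_i (1 + spin x i * spin y i) = (x == y)%:R * (2 ^ n)%:R :> R.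
Proof.
case: eqP => [->|/eqP nxy].
  under eq_bigr do rewrite spin_mul eqxx mul0rn subr0.
  by rewrite prodr_const card_ord mul1r natrX.
have [i nxyi] : exists i, x i != y i.
  apply/existsP; apply: contraNT nxy => /existsPn e.
  by apply/eqP/ffunP => i; apply/eqP; rewrite -[_ == _]negbK.
by rewrite (bigD1 i) //= spin_mul nxyi mul0r /=; ring.
Qed.

Lemma walsh_form_ge0 (R : realDomainType) n (A : {set cube n}) (w : {set 'I_n} -> R) :
  (forall S, 0 <= w S) ->
  0 <= \sum_(x in A) \sum_(y in A) \sum_S w S * (walsh S x * walsh S y).
Proof.
move=> w0.
(* Exchanging the sums diagonalises the form into weighted squares of the Fourier coefficients of
   the indicator of [A], up to scaling. *)
have -> : \sum_(x in A) \sum_(y in A) \sum_S w S * (walsh S x * walsh S y) =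
  \sum_S w S * (\sum_(x in A) walsh S x) ^+ 2.
  under eq_bigr do rewrite exchange_big.
  rewrite exchange_big; apply: eq_bigr => S _.
  rewrite expr2 mulr_suml mulr_sumr; apply: eq_bigr => x _.
  by rewrite !mulr_sumr.
by apply: sumr_ge0 => S _; rewrite mulr_ge0 ?sqr_ge0.
Qed.

Lemma sum_walsh_set0 (R : comPzRingType) n (x y : cube n) :
  \sum_(S : {set 'I_n}) (S == set0)%:R * (walsh S x * walsh S y) = 1 :> R.
Proof.
rewrite (bigD1 set0) //= eqxx mul1r /walsh !big_set0 mulr1 big1 ?addr0 // => S.
by move/negPf->; rewrite mul0r.
Qed.

Lemma sum_walsh_card1 (R : comPzRingType) n (x y : cube n) :
  \sum_(S : {set 'I_n}) (#|S| == 1)%:R * (walsh S x * walsh S y) =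
  \sum_i spin x i * spin y i :> R.
Proof.
rewrite (bigID (fun S : {set 'I_n} => #|S| == 1)) /= addrC big1 ?add0r; last first.
  by move=> S /negPf->; rewrite mul0r.
have -> : \sum_(S : {set 'I_n} | #|S| == 1) (#|S| == 1)%:R * (walsh S x * walsh S y) =
  \sum_(S in set1 @: [set: 'I_n]) walsh S x * walsh S y :> R.
  apply: eq_big => [S|S ->]; last by rewrite mul1r.
  apply/cards1P/imsetP => [[i ->]|[i _ ->]]; last by exists i.
  by exists i.
rewrite big_imset /=; last by move=> i j _ _; apply: set1_inj.
by apply: eq_big => [i|i _]; rewrite ?inE // /walsh !big_set1.
Qed.

(** The two corrections are chosen to make the weight vanish at levels 0 and 1; from level 2 on,
    [rho ^+ k <= rho ^+ 2]. *)
Lemma noise_weight_ge0 (R : realDomainType) (rho : R) k : 0 <= rho <= 1 ->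
  0 <= rho ^+ 2 - (- rho) ^+ k + (1 - rho ^+ 2) * (k == 0)%:R
       - (rho + rho ^+ 2) * (k == 1)%:R.
Proof.
move=> /andP[r0 r1]; case: k => [|[|k]] /=.
- by rewrite expr0 mulr1 mulr0 subr0 addrA subrK subrr.
- by rewrite expr1 mulr0 addr0 mulr1 opprK addrC [rho + _]addrC addNr.
rewrite !mulr0 addr0 subr0 subr_ge0.
apply: le_trans (ler_norm _) _; rewrite normrX normrN ger0_norm //.
by rewrite ler_wiXn2l.
Qed.

Lemma noise_bound (R : realDomainType) n (A : {set cube n}) (rho : R) :
  0 <= rho <= 1 ->
  (rho + rho ^+ 2) *
    (n%:R * #|A|%:R ^+ 2 - (\sum_(x in A) \sum_(y in A) (dH x y)%:R) *+ 2)
  <= rho ^+ 2 * (2 ^ n)%:R * #|A|%:R + (1 - rho ^+ 2) * #|A|%:R ^+ 2.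
Proof.
move=> hr; have /andP[r0 r1] := hr.
have := walsh_form_ge0 _ _ A _ (fun S => noise_weight_ge0 R rho #|S| hr).
(* Each summand of the weight is turned back into an explicit kernel: diagonal, noise, constant and
   Hamming distance. *)
have kerE x y : \sum_(S : {set 'I_n}) (rho ^+ 2 - (- rho) ^+ #|S|
      + (1 - rho ^+ 2) * (#|S| == 0)%:R - (rho + rho ^+ 2) * (#|S| == 1)%:R)
      * (walsh S x * walsh S y) =
    rho ^+ 2 * ((x == y)%:R * (2 ^ n)%:R)
    - \prod_i (1 + - rho * (spin x i * spin y i)) + (1 - rho ^+ 2)
    - (rho + rho ^+ 2) * (n%:R - (dH x y)%:R *+ 2).
  rewrite -prod_noise1 -sum_spin_mul -sum_walsh_card1 prod_noise.
  under [X in rho ^+ 2 * X]eq_bigr do rewrite -[X in 1 + X]mul1r.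
  rewrite prod_noise -[X in _ + X - _]mulr1 -[X in _ + _ * X - _](sum_walsh_set0 _ _ x y).
  rewrite !mulr_sumr -!sumrB -big_split -sumrB /=; apply: eq_bigr => S _.
  by rewrite cards_eq0 expr1n; ring.
(* Every factor is [1 - rho] or [1 + rho]; this is where [rho <= 1] matters for the kernel. *)
have prod_ge0 (x y : cube n) : 0 <= \prod_i (1 + - rho * (spin x i * spin y i)).
  apply: prodr_ge0 => i _; rewrite spin_mul; case: (x i != y i) => /=; lra.
have diagE : \sum_(x in A) \sum_(y in A) (x == y)%:R = #|A|%:R :> R.
  rewrite -sum1_card natr_sum; apply: eq_bigr => x xA.
  by rewrite (bigD1 x) //= eqxx big1 ?addr0 // => y /andP[_]; rewrite eq_sym => /negPf->.
have constE (c : R) : \sum_(x in A) \sum_(y in A) c = c * #|A|%:R ^+ 2.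
  by rewrite !sumr_const expr2 -natrM mulr_natr mulrnA.
(* The new integrand is that of [kerE] without the subtracted noise product, so it can only be
   larger. *)
move=> /le_trans-/(_ (\sum_(x in A) \sum_(y in A)
  ((rho ^+ 2 * (2 ^ n)%:R) * (x == y)%:R
   + (1 - rho ^+ 2 - (rho + rho ^+ 2) * n%:R)
   + (rho + rho ^+ 2) *+ 2 * (dH x y)%:R))) H.
rewrite -subr_ge0; apply: le_trans (H _) _.
  apply: ler_sum => x _; apply: ler_sum => y _; rewrite kerE.
  have := prod_ge0 x y; set P := \prod_i _ => P0.
  by rewrite -subr_ge0; apply: le_trans P0 _; rewrite le_eqVlt; apply/orP; left; apply/eqP; ring.
under eq_bigr do rewrite !big_split -!mulr_sumr.
rewrite !big_split -!mulr_sumr /= !constE diagE.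
by rewrite le_eqVlt; apply/orP; left; apply/eqP; ring.
Qed.

Lemma avg_dist_ge (R : realFieldType) n (A : {set cube n}) (rho : R) :
  (0 < #|A|)%N -> 0 < rho <= 1 ->
  n%:R / 2 - (rho ^+ 2 / (#|A|%:R / (2 ^ n)%:R) + 1 - rho ^+ 2) / (2 * rho * (1 + rho))
  <= avg_dist R A.
Proof.
move=> A0 /andP[r0 r1].
have := noise_bound R n A rho; rewrite (ltW r0) r1 => /(_ isT).
rewrite /avg_dist natrX; set T := \sum_(x in A) _; set m : R := #|A|%:R => H.
have m0 : 0 < m by rewrite ltr0n.
have N0 : 0 < (2 ^ n)%:R :> R by rewrite ltr0n expn_gt0.
(* Multiplying by this factor clears denominators and recovers [noise_bound]. *)
have K0 : 0 < 2 * (rho + rho ^+ 2) * m ^+ 2.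
  by rewrite !mulr_gt0 ?exprn_gt0 ?addr_gt0 ?exprn_gt0.
rewrite -subr_ge0 -(pmulr_rge0 _ K0).
rewrite -subr_ge0 in H; apply: le_trans H _.
rewrite le_eqVlt; apply/orP; left; apply/eqP; field.
by rewrite -natrX -/m (gt_eqF N0) (gt_eqF m0) (gt_eqF r0) gt_eqF ?addr_gt0.
Qed.

Theorem theorem1 (R : rcfType) (n M : nat) (A : {set cube n}) :
  (1 <= n)%N -> (1 <= M)%N -> (M <= 2 ^ n.-1)%N -> #|A| = M ->
  avg_dist R A >= n%:R / 2 - phi (M%:R / (2 ^ n)%:R : R).
Proof.
move=> _ M0 _ AM; rewrite -AM in M0 *.
have bound := avg_dist_ge R n A _ M0.
set a : R := #|A|%:R / (2 ^ n)%:R in bound *.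
have a0 : 0 < a by rewrite divr_gt0 ?ltr0n ?expn_gt0.
rewrite /phi; case: ifP => a14; last first.
  (* At [rho = 1] the term [1 - rho ^+ 2] vanishes and [(4 * a)^-1] remains. *)
  have := bound 1; rewrite ltr01 lexx => /(_ isT).
  congr (_ - _ <= _); field; exact: lt0r_neq0.
set r := Num.sqrt a.
have r0 : 0 < r by rewrite sqrtr_gt0.
have ra : r ^+ 2 = a by rewrite sqr_sqrtr // ltW.
(* The case hypothesis [a <= 4^-1] is exactly what makes [r / (1 - r)] at most 1, hence an
   admissible [rho]. *)
have r12 : r <= 1 / 2 by move: a14; rewrite -ra; nra.
have q0 : 0 < 1 - r by lra.
have := bound (r / (1 - r)); rewrite divr_gt0 //= ler_pdivrMr //.
have -> : r <= 1 * (1 - r) by lra.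
(* The numerator becomes [2 / (1 - r)] and the denominator [2 * r / (1 - r) ^+ 2], with quotient
   [r^-1 - 1]. *)
move=> /(_ isT); rewrite -ra; congr (_ - _ <= _); field.
by rewrite !gt_eqF //; lra.
Qed.
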